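(* Let $m>3$ be an integer with $r$ distinct prime divisors. Fix $h$ and functions $k_1,\dots,k_h\colon\mathbb{N}\to\mathbb{N}$ with $\prod_i k_i(n)=n$. Let $C$ be an $\mathbf{Aut}(\mathcal{T}_n^{\boldsymbol{k}})$-symmetric rigid $\mathrm{MOD}_m$-circuit on $x_1,\dots,x_n$ and let $B$ be a block of $\mathcal{T}_n^{\boldsymbol{k}}$ with $|B|=k_j(n)$ for some $j\in[h]$. Suppose every gate $g$ of $C$ has a defined $B$-support $\mathrm{supp}_B(g)$ and $\max_g|\mathrm{supp}_B(g)|<(k_j(n)/m)^{1/r}$. Then $C$ does not compute $\mathrm{AND}_n$.
   Context: $\mathrm{MOD}_m$-circuits: finite DAGs with multiwires, one output gate, one input gate per variable, other gates labelled $\mathrm{MOD}_m^R$ ($R\subseteq\mathbb{Z}_m$; output $1$ iff sum of inputs with multiplicity mod $m$ lies in $R$). $\mathcal{T}_n^{\boldsymbol{k}}$: rooted tree with levels $0,\dots,h$ (root on level $h$), each node on level $i\in[h]$ having $k_i(n)$ children, leaves identified with $[n]$; $\mathbf{Aut}(\mathcal{T}_n^{\boldsymbol{k}})$ is its automorphism group, acting on variables through leaves. A block is the set of all children of some node. $C$ is $\Gamma$-symmetric ($\Gamma=\mathbf{Aut}(\mathcal{T}_n^{\boldsymbol{k}})$) if each $\pi\in\Gamma$ extends to a circuit automorphism (preserving labels and multiplicities) mapping the input gate of $x_i$ to that of $x_{\pi(i)}$; rigid if only the identity automorphism fixes all input gates, so $\Gamma$ acts on gates with stabilisers $\mathrm{Stab}(g)\le\Gamma$.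 For $\Delta\le\Gamma$ and block $B$, $\Delta|_B\le\mathbf{Sym}(B)$ consists of the permutations of $B$ induced by elements of $\Delta$ mapping $B$ to itself; $S\subseteq B$ is a $B$-support of $\Delta$ if every permutation of $B$ fixing $S$ pointwise lies in $\Delta|_B$; $\mathrm{supp}_B(g)$ is the unique minimal $B$-support of $\mathrm{Stab}(g)$.
   Formalization: The formal theorem additionally assumes k_j(n) > 1 and n > 0: for a one-element block all supports are empty and e.g. the gate MOD_m^{{1}}(x_1) computes AND_1, and for n = 0 a constant gate computes AND_0, so the claim fails there. *)

(* Defs.v *)
From mathcomp Require Import all_boot all_order all_algebra all_fingroup.

Set Implicit Arguments.
Unset Strict Implicit.
Unset Printing Implicit Defensive.

Import GRing.Theory.

(** * MOD_m-circuits *)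

(* [wires a b] is the number of parallel wires from [a] to [b]. The label of a
   gate is [None] for an input gate and [Some R] for a MOD_m^R gate. 'Z_m is
   the ring of integers modulo m only for 1 < m. *)
Record mod_circuit (m n : nat) := ModCircuit {
  gate : finType;
  wires : gate -> gate -> nat;
  input : 'I_n -> gate;
  output : gate;
  label : gate -> option {set 'Z_m};
  input_inj : injective input;
  input_label : forall g, (label g == None) = (g \in codom input);
  input_source : forall a i, wires a (input i) = 0;
  wires_acyclic : forall a b, 0 < wires a b ->
    ~~ connect (fun c d => 0 < wires c d) b a
}.

Definition evaluation m n (C : mod_circuit m n) (x : {ffun 'I_n -> bool})
    (v : {ffun gate C -> bool}) : Prop :=
  (forall i, v (input C i) = x i) /\
  (forall g R, label g = Some R ->
     v g = (((\sum_a wires a g * v a)%:R : 'Z_m)%R \in R)).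

Definition computes m n (C : mod_circuit m n)
    (f : {ffun 'I_n -> bool} -> bool) : Prop :=
  forall x, exists2 v, evaluation x v & v (output C) = f x.

Definition AND n (x : {ffun 'I_n -> bool}) : bool := [forall i, x i].

Lemma evaluation_exists_unique m n (C : mod_circuit m n) x :
  exists! v : {ffun gate C -> bool}, evaluation x v.
Proof.
pose e c d := 0 < @wires _ _ C c d.
pose d g := #|[set a | connect e a g]|.
have dlt a b : 0 < wires a b -> d a < d b.
  move=> ab; apply/proper_card/properP; split.
    apply/subsetP=> c; rewrite !inE => ca.
    exact: connect_trans ca (connect1 ab).
  by exists b; rewrite !inE ?connect0 // (negPf (wires_acyclic ab)).
pose F (v : {ffun gate C -> bool}) : {ffun gate C -> bool} := [ffun g =>
  if label g is Some R then (((\sum_a wires a g * v a)%:R : 'Z_m)%R \in R)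
  else [exists i, (input C i == g) && x i]].
have FP v : evaluation x v <-> F v = v.
  split=> [[vi vg]|Fv].
    apply/ffunP=> g; rewrite ffunE; case E: (label g) => [R|]; first by rewrite (vg _ _ E).
    have /eqP/esym := E; rewrite input_label => /esym/codomP[i ->]; rewrite vi.
    apply/existsP/idP => [[j /andP[/eqP/input_inj-> //]]|xi].
    by exists i; rewrite eqxx.
  split=> [i|g R E]; rewrite -{1}Fv ffunE ?E //.
  have /eqP-> : label (input C i) == None by rewrite input_label codom_f.
  apply/existsP/idP => [[j /andP[/eqP/input_inj-> //]]|xi].
  by exists i; rewrite eqxx.
have FE (v w : {ffun gate C -> bool}) t :
    (forall g, d g < t -> v g = w g) -> forall g, d g <= t -> F v g = F w g.
  move=> vw g gt; rewrite !ffunE; case: (label g) => // R.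
  congr ((_%:R)%R \in R); apply: eq_bigr => a _.
  case: (posnP (wires a g)) => [->|/dlt ag]; first by rewrite !mul0n.
  by rewrite (vw a) // (leq_trans ag).
have it v w t g : d g < t -> iter t F v g = iter t F w g.
  elim: t g => // t IH g gt; exact: (FE _ _ t).
pose N := #|gate C|.+1.
have dN g : d g < N by rewrite ltnS max_card.
have fixE v w : F w = w -> iter N F v = w.
  move=> Fw; apply/ffunP=> g; rewrite (it v w) //.
  by rewrite (iter_fix _ Fw).
pose v0 : {ffun gate C -> bool} := [ffun=> false].
exists (iter N F v0); split=> [|w /FP]; last exact: fixE.
by apply/FP/ffunP=> g; rewrite -iterS iterSr (it _ v0).
Qed.

(** * Trees with prescribed branching *)

(* Rooted trees with levels 0, ..., h in which a node on level i + 1 has k i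
   children, for i < h: the function called k_i, 1 <= i <= h, in the usual
   indexing is [k (i - 1)] here. [child u v] reads "v is a child of u". Since
   the set of nodes is finite and levels strictly increase towards the root,
   these axioms force the root to be the only node on level h, to have no
   parent, and to be an ancestor of every node. [leaf] is the identification of
   {0, ..., n-1} with the leaves. *)
Record level_tree (h n : nat) (k : 'I_h -> nat) := LevelTree {
  node : finType;
  root : node;
  level : node -> nat;
  child : rel node;
  leaf : 'I_n -> node;
  level_root : level root = h;
  level_child : forall u v, child u v -> level u = (level v).+1;
  parent_unique : forall v, v != root -> exists! u, child u v;
  card_children : forall (i : 'I_h) u, level u = i.+1 ->
    #|[set v | child u v]| = k i;
  leaf_inj : injective leaf;
  leaf_level : forall v, (level v == 0) = (v \in codom leaf)
}.

Definition tree_aut h n (k : 'I_h -> nat) (T : level_tree n k) :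
    {set {perm node T}} :=
  [set p : {perm node T} | (p (root T) == root T) &&
     [forall u, forall v, child (p u) (p v) == child u v]].

Definition is_block h n (k : 'I_h -> nat) (T : level_tree n k)
    (B : {set node T}) : Prop :=
  exists u, B = [set v | child u v].

(** * Symmetric and rigid circuits *)

Definition circuit_aut m n (C : mod_circuit m n) : {set {perm gate C}} :=
  [set s : {perm gate C} | [&& s (output C) == output C,
     [forall g, label (s g) == label g] &
     [forall a, forall b, wires (s a) (s b) == wires a b]]].

Definition extends m n h (k : 'I_h -> nat) (C : mod_circuit m n)
    (T : level_tree n k) (p : {perm node T}) (s : {perm gate C}) : bool :=
  [forall i, forall j, (p (leaf T i) == leaf T j) ==>
     (s (input C i) == input C j)].

Definition tree_symmetric m n h (k : 'I_h -> nat) (C : mod_circuit m n)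
    (T : level_tree n k) : Prop :=
  forall p, p \in tree_aut T -> exists2 s, s \in circuit_aut C & extends p s.

Definition rigid m n (C : mod_circuit m n) : Prop :=
  forall s, s \in circuit_aut C ->
    (forall i, s (input C i) = input C i) -> s = 1%g.

(* In a symmetric rigid circuit the automorphism s extending p is unique, and
   p |-> s is the action of Aut(T) on the gates. *)
Definition gate_stab m n h (k : 'I_h -> nat) (C : mod_circuit m n)
    (T : level_tree n k) (g : gate C) : {set {perm node T}} :=
  [set p in tree_aut T |
     [exists s in circuit_aut C, extends p s && (s g == g)]].

(** * Supports *)

(* Sym(B) is represented by the permutations of the ambient type that fix every
   point outside B. *)
Definition induced (V : finType) (D : {set {perm V}}) (B : {set V}) :
    {set {perm V}} :=
  [set restr_perm B p | p in D & [set p x | x in B] == B].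

Definition is_support (V : finType) (D : {set {perm V}}) (B S : {set V}) :
    Prop :=
  S \subset B /\
  (forall q, q \in Sym B -> (forall x, x \in S -> q x = x) -> q \in induced D B).

(* The unique minimal support is minimal in cardinality: for the stabiliser of
   a point b in a block B with at least two elements, both [set b] and B :\ b
   are minimal for inclusion. *)
Definition is_min_support (V : finType) (D : {set {perm V}}) (B S : {set V}) :
    Prop :=
  is_support D B S /\
  (forall S', is_support D B S' -> S' <> S -> #|S| < #|S'|).

(* Main.v *)
(* Restrict to the inputs x_A, A a subset of B, that are 0 exactly on the leaves
   below B \ A. With t the largest support size, let
   Q = m * prod_(p | m) p^(floor(log_p t)); then Q <= m t^r < |B|, and
   z |-> 'C(z, d) mod m has period Q for all d <= t. By induction on the circuit,
   the value of a gate g at x_A depends only on A :&: supp g and on |A| mod Q: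
   group the wires into g according to the support E of their source. Since
   Stab(g) realises every permutation of B fixing supp g, and supports move along
   with gates, the contribution of E depends only on E :&: supp g and on the
   numbers i, j of points of E \ supp g inside and outside A; the number of sets
   E of a given type is a product of binomials 'C(_, i) * 'C(_, j), which is
   Q-periodic modulo m. The output gate has empty support, because every
   permutation of B lifts to the tree, so it cannot distinguish A = B from a set
   A of size |B| - Q. *)

From mathcomp Require Import all_boot all_order all_algebra all_fingroup.
From mathcomp Require Import reals exp.
Require Import Defs.

Set Implicit Arguments.
Unset Strict Implicit.
Unset Printing Implicit Defensive.

Import GRing.Theory Num.Theory.

(** * Levels, parents and the lifting of block permutations to the tree *)

(** Parents lie strictly higher and levels are bounded by [M], so climbing from [v] ends at the
    root, which is on level [h]. *)
Lemma level_lt_height h n (k : 'I_h -> nat) (T : level_tree n k) (v : node T) :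
  v != root T -> level v < h.
Proof.
pose M := \max_(u : node T) level u.
have [t] := ubnP (M - level v); elim: t v => // t IH v lt_t v_root.
have [u [uv _]] := parent_unique v_root.
have lu := level_child uv.
have [u_root|u_root] := eqVneq u (root T).
  by apply: eq_leq; rewrite -lu u_root level_root.
apply: ltnW; rewrite -lu; apply: IH => //.
have : level u <= M by apply: leq_bigmax.
by rewrite lu => uM; rewrite -ltnS (leq_trans _ lt_t) // ltnS ltn_sub2l.
Qed.

Lemma level_le_height h n (k : 'I_h -> nat) (T : level_tree n k) (v : node T) :
  level v <= h.
Proof.
by have [->|/level_lt_height/ltnW//] := eqVneq v (root T); rewrite level_root.
Qed.

Lemma child_neq_root h n (k : 'I_h -> nat) (T : level_tree n k) (u v : node T) :
  child u v -> v != root T.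
Proof.
move=> /level_child uv; apply: contraTneq (level_le_height u) => v_root.
by rewrite uv v_root level_root ltnn.
Qed.

Lemma parent_inj h n (k : 'I_h -> nat) (T : level_tree n k) (u u' v : node T) :
  child u v -> child u' v -> u = u'.
Proof.
move=> uv u'v; have [w [_ wP]] := parent_unique (child_neq_root uv).
by rewrite -(wP _ uv) (wP _ u'v).
Qed.

Definition parent h n (k : 'I_h -> nat) (T : level_tree n k) (v : node T) :=
  odflt v [pick u | child u v].

Lemma child_parent h n (k : 'I_h -> nat) (T : level_tree n k) (v : node T) :
  v != root T -> child (parent v) v.
Proof.
move=> /parent_unique [u [uv _]]; rewrite /parent.
by case: pickP => [//|/(_ u)]; rewrite uv.
Qed.

Lemma parentE h n (k : 'I_h -> nat) (T : level_tree n k) (u v : node T) :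
  child u v -> parent v = u.
Proof. by move=> uv; apply/parent_inj/uv/child_parent/child_neq_root/uv. Qed.

Lemma root_ind h n (k : 'I_h -> nat) (T : level_tree n k)
    (P : node T -> Prop) :
  P (root T) -> (forall u v, child u v -> P u -> P v) -> forall v, P v.
Proof.
move=> P0 PS v; have [t] := ubnP (h - level v); elim: t v => // t IH v lt_t.
have [->//|v_root] := eqVneq v (root T).
have uv := child_parent v_root; apply: (PS _ _ uv); apply: IH.
rewrite (level_child uv) -ltnS (leq_trans _ lt_t) // ltnS ltn_sub2l //.
exact: level_lt_height.
Qed.

Definition children h n (k : 'I_h -> nat) (T : level_tree n k) (u : node T) :=
  enum [set v | child u v].

Lemma mem_children h n (k : 'I_h -> nat) (T : level_tree n k) (u v : node T) :
  (v \in children u) = child u v.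
Proof. by rewrite mem_enum inE. Qed.

Lemma size_children h n (k : 'I_h -> nat) (T : level_tree n k)
    (u u' : node T) :
  level u = level u' -> size (children u) = size (children u').
Proof.
move=> luu'; rewrite /children -!cardE.
case lu: (level u) => [|i].
  have none w : level w = 0 -> [set v | child w v] = set0.
    move=> lw; apply/setP=> v; rewrite !inE; apply/negP=> /level_child.
    by rewrite lw.
  by rewrite !none // -luu'.
have ih : i < h by rewrite -lu level_le_height.
by rewrite !(@card_children _ _ _ T (Ordinal ih)) // -luu'.
Qed.

(* A node is sent to the child of the image of its parent with the same rank
   among its siblings as its image under [q]. The fuel [h - level v] runs out
   exactly at the root. *)
Fixpoint tree_lift_rec h n (k : 'I_h -> nat) (T : level_tree n k)
    (q : node T -> node T) (t : nat) (v : node T) : node T :=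
  if t is t'.+1 then
    nth v (children (tree_lift_rec q t' (parent v))) (index (q v) (children (parent v)))
  else v.

Definition tree_lift h n (k : 'I_h -> nat) (T : level_tree n k)
    (q : node T -> node T) (v : node T) := tree_lift_rec q (h - level v) v.

Lemma tree_lift_root h n (k : 'I_h -> nat) (T : level_tree n k)
    (q : node T -> node T) : tree_lift q (root T) = root T.
Proof. by rewrite /tree_lift level_root subnn. Qed.

Lemma tree_liftE h n (k : 'I_h -> nat) (T : level_tree n k)
    (q : node T -> node T) (u v : node T) :
  child u v ->
  tree_lift q v = nth v (children (tree_lift q u)) (index (q v) (children u)).
Proof.
move=> uv; rewrite /tree_lift.
have -> : h - level v = (h - level u).+1.
  rewrite (level_child uv) -subSn ?subSS //.
  by rewrite -(level_child uv) level_le_height.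
by rewrite /= (parentE uv).
Qed.

(** The number of children depends only on the level, so [tree_lift] keeps sibling ranks in range
    and carries the subtrees below [B] along with their roots. *)
Lemma perm_block_lifts h n (k : 'I_h -> nat) (T : level_tree n k)
    (B : {set node T}) (q : {perm node T}) :
  is_block B -> q \in Sym B ->
  exists2 p, p \in tree_aut T & {in B, p =1 q}.
Proof.
move=> [u0 BE] qB; pose F := tree_lift (T := T) q.
have qout v : v \notin B -> q v = v.
  by move=> vB; apply: out_perm vB; move: qB; rewrite inE.
have qchild u v : child u v -> child u (q v).
  move=> uv; have [vB|/qout->//] := boolP (v \in B).
  have : q v \in B by rewrite perm_closed //; move: qB; rewrite inE.
  by move: vB; rewrite BE !inE => /parent_inj /(_ uv) ->.
have level_F : forall v, level (F v) = level v.
  elim/root_ind=> [|u v uv IH]; first by rewrite /F tree_lift_root.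
  have : F v \in children (F u).
    rewrite /F (tree_liftE _ uv) mem_nth // (size_children IH) index_mem.
    by rewrite mem_children qchild.
  by rewrite mem_children => /level_child; rewrite IH (level_child uv) => -[].
have child_F u v : child u v -> child (F u) (F v).
  move=> uv; rewrite -mem_children /F (tree_liftE _ uv) mem_nth //.
  by rewrite (size_children (level_F _)) index_mem mem_children qchild.
(* Nodes with equal images have parents with equal images; by induction from the root they are
   siblings, and equal ranks identify them. *)
have F_inj : injective F.
  elim/root_ind=> [|u v uv IH] w.
    rewrite {1}/F tree_lift_root => Fw; apply/esym/eqP.
    apply: contraT => /level_lt_height.
    by rewrite -level_F -Fw level_root ltnn.
  move=> FE; have w_root : w != root T.
    apply: contraTneq (child_F _ _ uv); rewrite FE => ->.
    by apply/negP=> /child_neq_root; rewrite /F tree_lift_root eqxx.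
  have uw := child_parent w_root; set u' := parent w in uw.
  have Fu : F u = F u'.
    by apply: parent_inj (child_F _ _ uv) _; rewrite FE child_F.
  move/IH: Fu uw => <- uw; move: FE; rewrite /F !(tree_liftE _ uv) !(tree_liftE _ uw).
  (* The two sides carry different defaults, [v] and [w], which must agree before [nth_uniq]
     applies. *)
  rewrite (set_nth_default w); last first.
    by rewrite (size_children (level_F _)) index_mem mem_children qchild.
  move/eqP; rewrite nth_uniq ?enum_uniq //; 
    try by rewrite (size_children (level_F _)) index_mem mem_children qchild.
  move/eqP/(congr1 (nth v (children u))).
  by rewrite !nth_index ?mem_children ?qchild // => /perm_inj.
(* [q] moves only nodes of [B], one level below [u0], so [F] fixes everything from the level of [u0]
   upward and hence restricts to [q] on [B]. *)
have F_id v : level u0 <= level v -> F v = v.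
  elim/root_ind: v => [|u v uv IH] le_v; first by rewrite /F tree_lift_root.
  rewrite /F (tree_liftE _ uv) -/F IH; last first.
    by rewrite (level_child uv) ltnW.
  rewrite qout ?nth_index ?mem_children //.
  by apply: contraTN le_v; rewrite BE inE => /level_child ->; rewrite ltnn.
exists (perm F_inj) => [|v vB]; last first.
  have u0v : child u0 v by move: vB; rewrite BE inE.
  rewrite permE /F (tree_liftE _ u0v) -/F F_id // nth_index //.
  by rewrite mem_children qchild.
rewrite inE permE /F tree_lift_root eqxx -/F /=.
apply/forallP=> u; apply/forallP=> v; rewrite !permE.
apply/eqP; apply/idP/idP => [FuFv|/child_F//].
have v_root : v != root T.
  apply: contraTneq FuFv => ->.
  by apply/negP=> /child_neq_root; rewrite /F tree_lift_root eqxx.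
have pv := child_parent v_root.
by rewrite (F_inj _ _ (parent_inj FuFv (child_F _ _ pv))).
Qed.

Lemma tree_aut_child h n (k : 'I_h -> nat) (T : level_tree n k) p (u v : node T) :
  p \in tree_aut T -> child (p u) (p v) = child u v.
Proof. by rewrite inE => /andP[_ /forallP/(_ u)/forallP/(_ v)/eqP]. Qed.

Lemma tree_aut_level h n (k : 'I_h -> nat) (T : level_tree n k) p (v : node T) :
  p \in tree_aut T -> level (p v) = level v.
Proof.
move=> pT; elim/root_ind: v => [|u v uv IH].
  by move: pT; rewrite inE => /andP[/eqP->].
by apply/succn_inj; rewrite -(level_child uv) -IH; apply/esym/level_child;
  rewrite tree_aut_child.
Qed.

Lemma tree_aut_leaf h n (k : 'I_h -> nat) (T : level_tree n k) p (i : 'I_n) :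
  p \in tree_aut T -> exists j, p (leaf T i) = leaf T j.
Proof.
move=> pT; apply/codomP; rewrite -leaf_level tree_aut_level //.
by rewrite leaf_level codom_f.
Qed.

Lemma tree_aut_mul h n (k : 'I_h -> nat) (T : level_tree n k) p q :
  p \in tree_aut T -> q \in tree_aut T -> (p * q)%g \in tree_aut T.
Proof.
move=> pT qT; rewrite inE permM.
move: (pT) (qT); rewrite !inE => /andP[/eqP-> _] /andP[/eqP-> _]; rewrite eqxx.
by apply/forallP=> u; apply/forallP=> v; rewrite !permM !tree_aut_child.
Qed.

Lemma tree_aut_inv h n (k : 'I_h -> nat) (T : level_tree n k) p :
  p \in tree_aut T -> (p^-1)%g \in tree_aut T.
Proof.
move=> pT; rewrite inE; move: (pT); rewrite inE => /andP[/eqP pr _].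
rewrite -{1}pr permK eqxx.
by apply/forallP=> u; apply/forallP=> v; rewrite -(tree_aut_child _ _ pT) !permKV.
Qed.

Lemma tree_aut_connect h n (k : 'I_h -> nat) (T : level_tree n k) p (u v : node T) :
  p \in tree_aut T -> connect (@child _ _ _ T) (p u) (p v) = connect (@child _ _ _ T) u v.
Proof.
have conn q x y : q \in tree_aut T ->
    connect (@child _ _ _ T) x y -> connect (@child _ _ _ T) (q x) (q y).
  move=> qT /connectP[s]; elim: s x => [|z s IH] x /=; first by move=> _ ->.
  move=> /andP[xz zs] /(IH _ zs); apply: connect_trans.
  by rewrite connect1 // tree_aut_child.
move=> pT; apply/idP/idP; last exact: conn.
by move/(conn _ _ _ (tree_aut_inv pT)); rewrite !permK.
Qed.

(** The ancestors of [w] form a chain: passing to the parent of [w] keeps both connections unless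
    [u] or [v] is [w], and then equal levels force both to be. *)
Lemma connect_level h n (k : 'I_h -> nat) (T : level_tree n k) (u v w : node T) :
  level u = level v -> connect (@child _ _ _ T) u w -> connect (@child _ _ _ T) v w -> u = v.
Proof.
have conn (x y : node T) : connect (@child _ _ _ T) x y -> level y <= level x /\
    (forall z, child z y -> x = y \/ connect (@child _ _ _ T) x z).
  move=> /connectP[s]; elim/last_ind: s y => [|s z IH] y /=.
    by move=> _ ->; split=> // z _; left.
  rewrite rcons_path last_rcons => /andP[xs lz] ->.
  have [le_l _] := IH _ xs erefl.
  split; first by rewrite (leq_trans _ le_l) // (level_child lz) leqnSn.
  move=> c cz; right; rewrite -(parent_inj lz cz); apply/connectP.
  by exists s.
elim/root_ind: w => [|c w cw IH] luv uw vw.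
  have rt x : connect (@child _ _ _ T) x (root T) -> x = root T.
    move=> /conn[]; have [//|/level_lt_height x_lt] := eqVneq x (root T).
    by rewrite level_root leqNgt x_lt.
  by rewrite (rt u) // (rt v).
have [lu /(_ _ cw) cu] := conn _ _ uw; have [lv /(_ _ cw) cv] := conn _ _ vw.
have lc x : connect (@child _ _ _ T) x c -> level w < level x.
  by move=> /conn[le_c _]; rewrite (leq_trans _ le_c) // (level_child cw).
case: cu cv => [uE|cu] [vE|cv]; last exact: IH.
- by rewrite uE vE.
- by move: (lc _ cv); rewrite -luv uE ltnn.
- by move: (lc _ cu); rewrite luv vE ltnn.
Qed.

Lemma leaf_below h n (k : 'I_h -> nat) (T : level_tree n k) (u : node T) :
  (forall i, 0 < k i) -> exists i, connect (@child _ _ _ T) u (leaf T i).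
Proof.
move=> k_gt0; move lu: (level u) => l; elim: l u lu => [|l IH] u lu.
  have /codomP[i ->] : u \in codom (leaf T) by rewrite -leaf_level lu.
  by exists i.
have lh : l < h by rewrite -lu level_le_height.
have /card_gt0P[v] : 0 < #|[set v | child u v]|.
  by rewrite (@card_children _ _ _ T (Ordinal lh)).
rewrite inE => uv; have [|i vi] := IH v.
  by apply: succn_inj; rewrite -(level_child uv).
by exists i; apply: connect_trans vi; apply: connect1.
Qed.

(** * Binomial coefficients modulo [m] *)

Definition period m s := m * \prod_(p <- primes m) p ^ trunc_log p s.

Lemma period_le m s : 0 < s -> period m s <= m * s ^ size (primes m).
Proof.
move=> s_gt0; rewrite /period leq_mul2l; apply/orP; right.
have: all prime (primes m) by apply/allP=> p; rewrite mem_primes => /andP[].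
elim: (primes m) => [|p ps IH] /=; first by rewrite big_nil.
move=> /andP[/prime_gt1 p_gt1 /IH le_ps].
by rewrite big_cons expnS leq_mul // trunc_logP.
Qed.

(** In [i * 'C(M, i) = M * 'C(M.-1, i.-1)] the p-adic valuation of [i] is at most [trunc_log p s].
    The period contains this power of [p] on top of the p-part of [m], so the latter survives in the
    binomial. *)
Lemma dvdn_bin_period m s M i :
  0 < m -> 0 < i <= s -> period m s %| M -> m %| 'C(M, i).
Proof.
move=> m_gt0; case: i => // i /= is_le dvdM.
have [->|C_gt0] := posnP 'C(M, i.+1); first by rewrite dvdn0.
have M_gt0 : 0 < M by case: (M) C_gt0.
apply/dvdn_partP=> // p pm; rewrite p_part.
have p_pr : prime p by move: pm; rewrite mem_primes => /andP[].
rewrite pfactor_dvdn // -(leq_add2l (logn p i.+1)) -[leqRHS]lognM //.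
rewrite -mul_bin_diag.
have le_i : logn p i.+1 <= trunc_log p s.
  apply: trunc_log_max; first exact: prime_gt1.
  by apply: leq_trans is_le; apply: dvdn_leq => //; apply: pfactor_dvdnn.
have C'_gt0 : 0 < 'C(M.-1, i) by move: C_gt0; rewrite !bin_gt0; case: (M) M_gt0.
rewrite lognM //; apply: leq_trans (leq_addr _ _).
rewrite -pfactor_dvdn // expnD mulnC; apply: dvdn_trans dvdM.
rewrite dvdn_mul ?pfactor_dvdnn // (big_rem p) //= dvdn_mulr //.
exact: dvdn_exp2l.
Qed.

(** Expanding ['C(M + z', d)] with [M = z - z'] by Vandermonde, every term but the one with
    ['C(M, 0)] vanishes modulo [m]. *)
Lemma bin_mod_period m s d z z' :
  0 < m -> d <= s -> z = z' %[mod period m s] -> 'C(z, d) = 'C(z', d) %[mod m].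
Proof.
move=> m_gt0 ds; wlog le_z : z z' / z' <= z => [IH|].
  by case: (leqP z' z) => [|/ltnW] le_z zz'; [|apply/esym]; apply: IH.
move/eqP; rewrite eqn_mod_dvd //; set M := z - z' => dvdM.
rewrite -(subnK le_z) -/M -binomial.Vandermonde big_ord_recl bin0 mul1n subn0.
set S := \sum_(_ < _) _; have dvdS : m %| S; last first.
  by rewrite -modnDmr (eqP dvdS) addn0.
apply: dvdn_sum => i _; apply: dvdn_mulr.
apply: dvdn_bin_period dvdM => //=.
by rewrite (leq_trans _ ds) // /bump leq0n add1n.
Qed.

(** * Subsets of the block classified by their trace *)

(** Equal fibre sizes make the two lists of values permutations of each other; the matching of
    indices is carried to [V] by [enum_rank]. *)
Lemma perm_of_fibers (V : finType) (K : eqType) (f f' : V -> K) :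
  (forall c, #|[set x | f x == c]| = #|[set x | f' x == c]|) ->
  exists q : {perm V}, forall x, f (q x) = f' x.
Proof.
move=> cardf; have : perm_eq (codom f') (codom_tuple f).
  have count_fiber (g : V -> K) c :
      count_mem c (codom g) = #|[set x | g x == c]|.
    rewrite count_map -sum1_count -sum1_card big_enum_cond.
    by apply: eq_bigl => x; rewrite !inE.
  by apply/allP=> c _ /=; rewrite !count_fiber cardf.
move=> /tuple_permP[p pE].
have q_inj : injective (fun x : V => enum_val (p (enum_rank x))).
  by move=> x y /enum_val_inj/perm_inj/enum_rank_inj.
exists (perm q_inj) => x; rewrite permE.
have <- : nth (f x) (codom f') (enum_rank x) = f' x.
  by rewrite nth_codom enum_rankK.
rewrite pE (nth_map (enum_rank x)) ?size_enum_ord //.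
by rewrite nth_ord_enum (tnth_nth (f x)) /= nth_codom.
Qed.

(** Sizes are stored as ordinals so that traces form a finite type, by which a sum can be
    partitioned. *)
Definition card_ord_set (V : finType) (E : {set V}) : 'I_#|V|.+1 :=
  Ordinal (max_card (mem E) : #|E| < #|V|.+1).

Definition trace (V : finType) (S A E : {set V}) :=
  (E :&: S, card_ord_set (E :&: A :\: S), card_ord_set (E :\: A :\: S)).

Lemma card_trace (V : finType) (S A E : {set V}) :
  #|E| = #|E :&: S| + (#|E :&: A :\: S| + #|E :\: A :\: S|).
Proof.
rewrite -(cardsID S E) -(cardsID A (E :\: S)); congr (_ + (_ + _)).
  by apply: eq_card => x; rewrite !inE andbA andbC andbA andbC !andbA.
by apply: eq_card => x; rewrite !inE andbCA.
Qed.

(** [A] and [A'] may differ in size, so [q] cannot be asked to carry one to the other; they are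
    matched only inside [E] and [E']. *)
Lemma trace_perm (V : finType) (B S A A' E E' : {set V}) :
  E \subset B -> E' \subset B -> A :&: S = A' :&: S ->
  trace S A E = trace S A' E' ->
  exists q : {perm V}, [/\ q \in Sym B, {in S, forall x, q x = x},
    [set q x | x in E'] = E & {in E', forall x, (q x \in A) = (x \in A')}].
Proof.
move=> EB E'B AS [ES cA cD].
(* Points outside [B :\: S] are coloured by themselves, which forces [q] to fix them. The second
   Boolean records [Z] only inside [D], so all points of [B :\: S] outside [D] share one colour. *)
pose f (D Z : {set V}) x : V + bool * bool :=
  if x \in B :\: S then inr (x \in D, (x \in D) && (x \in Z)) else inl x.
have [c|q fq] := @perm_of_fibers _ _ (f E A) (f E' A').
  have cl y (D Z : {set V}) : [set x | f D Z x == inl y] = [set y] :\: (B :\: S).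
    apply/setP=> x; rewrite !inE /f inE.
    by case: (x \in S); case: (x \in B).
  have crt (D Z : {set V}) (a : bool) : D \subset B -> #|[set x | f D Z x == inr (true, a)]| =
      if a then #|D :&: Z :\: S| else #|D :\: Z :\: S|.
    move/subsetP=> DB; transitivity #|if a then D :&: Z :\: S else D :\: Z :\: S|.
      apply: eq_card => x; rewrite inE /f !(fun_if (fun X : {set V} => x \in X)).
      rewrite !inE; case xD: (x \in D); last by case: ifP => _; case: (a); rewrite ?andbF.
      by rewrite (DB x xD); case: (x \in S); case: (x \in Z); case: (a).
    by case: a.
  have crf (D Z : {set V}) : D \subset B -> #|[set x | f D Z x == inr (false, false)]| =
      #|B :\: S| - (#|D :&: Z :\: S| + #|D :\: Z :\: S|).
    move=> DB; have -> : #|D :&: Z :\: S| + #|D :\: Z :\: S| = #|(B :\: S) :&: D|.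
      have -> : (B :\: S) :&: D = D :\: S.
        apply/setP=> x; rewrite !inE; case xD: (x \in D); rewrite ?andbF //.
        by rewrite (subsetP DB) ?andbT.
      apply: (@addnI #|D :&: S|); rewrite -card_trace.
      by rewrite cardsID.
    rewrite -cardsD; apply: eq_card => x; rewrite !inE /f.
    by rewrite inE; case: (x \in D); case: (x \in Z); case: (_ && _).
  have cft (D Z : {set V}) : [set x | f D Z x == inr (false, true)] = set0.
    by apply/setP=> x; rewrite !inE /f; case: ifP => // _; case: (x \in D).
  case: c => [y|[[] a]]; rewrite ?cl //.
    by rewrite !crt // cA cD.
  by case: a; rewrite ?cft // !crf // cA cD.
have qid x : x \notin B :\: S -> q x = x.
  by move=> xBS; have := fq x; rewrite /f (negPf xBS); case: ifP => // _ [].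
have qE x : x \in B :\: S -> (q x \in E) = (x \in E') /\
    (x \in E' -> (q x \in A) = (x \in A')).
  move=> xBS; have := fq x; rewrite /f xBS; case: ifP => // _ [-> h].
  by split=> // xE; move: h; rewrite xE.
have memS (X Y : {set V}) x : X :&: S = Y :&: S -> x \in S -> (x \in X) = (x \in Y).
  by move/setP/(_ x); rewrite !inE => + xS; rewrite xS !andbT.
have qEE x : (q x \in E) = (x \in E').
  have [/qE[]//|xBS] := boolP (x \in B :\: S); rewrite (qid _ xBS).
  have [xS|xS] := boolP (x \in S); first exact: memS.
  move: xBS; rewrite inE xS /= => xB.
  by rewrite (contraNF (subsetP EB x) xB) (contraNF (subsetP E'B x) xB).
exists q; split.
- rewrite inE; apply/subsetP=> x; rewrite inE; apply: contraR => xB.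
  by rewrite qid // inE (negPf xB) andbF.
- by move=> x xS; rewrite qid // inE xS.
- apply/setP=> y; rewrite -[y](permKV q) mem_imset ?qEE //; exact: perm_inj.
move=> x xE; have [/qE[_]/(_ xE)//|xBS] := boolP (x \in B :\: S).
rewrite (qid _ xBS); apply: memS => //.
by move: xBS; rewrite inE (subsetP E'B) // andbT negbK.
Qed.

(** Such an [E] is [X] together with independent choices of [i] points of [A :\: S] and [j] points
    of [B :\: A :\: S]. *)
Lemma card_trace_fiber (V : finType) (B S A X : {set V}) (i j : 'I_#|V|.+1) :
  A \subset B -> S \subset B ->
  #|[set E : {set V} | (E \subset B) && (trace S A E == (X, i, j))]| =
    (X \subset S) * ('C(#|A :\: S|, i) * 'C(#|B :\: A :\: S|, j)).
Proof.
move=> AB SB; have [XS|XS] := boolP (X \subset S); last first.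
  rewrite mul0n; apply/eqP; rewrite cards_eq0; apply/eqP/setP=> E; rewrite !inE.
  apply: contraNF XS => /andP[_ /eqP[<- _ _]]; exact: subsetIr.
rewrite mul1n -!cards_draws -cardsX.
set D1 := [set E : {set V} | E \subset A :\: S & _].
set D2 := [set E : {set V} | E \subset B :\: A :\: S & _].
pose g (e : {set V} * {set V}) := X :|: e.1 :|: e.2.
have gP (e1 e2 : {set V}) : e1 \subset A :\: S -> e2 \subset B :\: A :\: S ->
    [/\ g (e1, e2) :&: S = X, g (e1, e2) :&: A :\: S = e1
      & g (e1, e2) :\: A :\: S = e2].
  move=> /subsetP s1 /subsetP s2; rewrite /g /=.
  have mem x : [&& (x \in e1) ==> (x \in A) && (x \notin S),
      (x \in e2) ==> [&& x \in B, x \notin A & x \notin S]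
      & (x \in X) ==> (x \in S)].
    apply/and3P; split; apply/implyP; last exact: (subsetP XS).
      by move/s1; rewrite !inE andbC.
    by move/s2; rewrite !inE => /and3P[-> -> ->].
  by split; apply/setP=> x; rewrite !inE; move: (mem x);
    case: (x \in e1); case: (x \in e2); case: (x \in X); case: (x \in A);
    case: (x \in S); case: (x \in B).
have <- : #|g @: setX D1 D2| = #|setX D1 D2|.
  apply: card_in_imset => -[e1 e2] [e1' e2']; rewrite !inE /=.
  move=> /andP[/andP[s1 _] /andP[s2 _]] /andP[/andP[s1' _] /andP[s2' _]] gE.
  have [_ h1 h2] := gP _ _ s1 s2; have [_ h1' h2'] := gP _ _ s1' s2'.
  move: h1 h2 h1' h2'; rewrite (gE : g (e1, e2) = g (e1', e2')).
  by move=> <- <- -> ->.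
apply: eq_card => E; rewrite inE; apply/andP/imsetP.
  move=> [EB /eqP[EX /(congr1 val)/= Ei /(congr1 val)/= Ej]].
  exists (E :&: A :\: S, E :\: A :\: S).
    rewrite !inE /= -Ei -Ej !eqxx !andbT !setSD ?subsetIr //.
  apply/setP=> x; rewrite /g -EX !inE /=.
  by case: (x \in E); case: (x \in A); case: (x \in S).
move=> [[e1 e2]]; rewrite !inE /= => /andP[/andP[s1 /eqP c1] /andP[s2 /eqP c2]] ->.
split; last first.
  have [gX g1 g2] := gP _ _ s1 s2; rewrite /trace gX; apply/eqP.
  by congr (_, _, _); apply: val_inj; rewrite /= ?g1 ?g2.
rewrite !subUset (subset_trans XS SB) (subset_trans s1) ?(subset_trans s2) //.
  by rewrite setDDl subsetDl.
exact: subset_trans (subsetDl _ _) AB.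
Qed.

(** [w D E] stands for the contribution of the sources with support [E] on the input given by [D].
    It is constant on each trace class, across both [A] and [A'], and class sizes are products of
    periodic binomials. *)
Lemma sum_trace_mod (V : finType) m s (B S A A' : {set V})
    (w : {set V} -> {set V} -> nat) :
  0 < m -> S \subset B -> A \subset B -> A' \subset B -> A :&: S = A' :&: S ->
  #|A| = #|A'| %[mod period m s] ->
  (forall D E : {set V}, ~~ ((E \subset B) && (#|E| <= s)) -> w D E = 0) ->
  (forall D D' E E' : {set V}, D \in [:: A; A'] -> D' \in [:: A; A'] ->
     E \subset B -> E' \subset B -> trace S D E = trace S D' E' ->
     w D E = w D' E') ->
  \sum_E w A E = \sum_E w A' E %[mod m].
Proof.
move=> m_gt0 SB AB A'B AS cAA' w0 wE.
have sum_w (D : {set V}) : \sum_E w D E = \sum_t \sum_(E : {set V} | (E \subset B) &&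
    (trace S D E == t)) w D E.
  rewrite (bigID (fun E : {set V} => E \subset B)) /=.
  rewrite [X in _ + X]big1 ?addn0 => [|E /negPf EB]; last by rewrite w0 // EB.
  by rewrite (partition_big (trace S D) xpredT).
rewrite !sum_w; elim/big_ind2: _ => // [x1 x2 y1 y2 xE yE|[[X i] j] _].
  by rewrite -modnDm xE yE modnDm.
(* Classes of sets larger than [s] contribute nothing; in the others [i] and [j] are at most [s], as
   [bin_mod_period] requires. *)
have [le_s|gt_s] := leqP (i + j) s; last first.
  rewrite !big1 // => E /andP[EB /eqP[_ /(congr1 val)/= Ei /(congr1 val)/= Ej]].
    by rewrite w0 // EB (card_trace S A' E) Ei Ej -ltnNge ltn_addl.
  by rewrite w0 // EB (card_trace S A E) Ei Ej -ltnNge ltn_addl.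
pose P (D E : {set V}) := (E \subset B) && (trace S D E == (X, i, j)).
have [c cP] : exists c, forall D E, D \in [:: A; A'] -> P D E -> w D E = c.
  have [/existsP[D0 /existsP[E0 /andP[D0A P0]]]|no] :=
      boolP [exists D : {set V}, exists E : {set V}, (D \in [:: A; A']) && P D E].
    exists (w D0 E0) => D E DA /andP[EB /eqP tE].
    by move: P0 => /andP[E0B /eqP tE0]; apply: wE; rewrite ?tE ?tE0.
  exists 0 => D E DA PE; case/negP: no.
  by apply/existsP; exists D; apply/existsP; exists E; rewrite DA.
have sum_c (D : {set V}) : D \in [:: A; A'] -> D \subset B -> \sum_(E : {set V} | P D E) w D E =
    (X \subset S) * ('C(#|D :\: S|, i) * 'C(#|B :\: D :\: S|, j)) * c.
  move=> DA DB; rewrite -(card_trace_fiber X i j DB SB) -sum_nat_const.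
  by apply: eq_big => E; rewrite ?inE //; apply: cP.
rewrite /P in sum_c; rewrite !sum_c ?inE ?eqxx ?orbT //.
have cD : #|A :\: S| = #|A' :\: S| %[mod period m s].
  by apply/eqP; rewrite -(eqn_modDl #|A :&: S|) {2}AS !cardsID; apply/eqP.
have cB (D : {set V}) : D \subset B -> #|D :\: S| + #|B :\: D :\: S| = #|B :\: S|.
  move=> DB; rewrite -(cardsID D (B :\: S)); congr (_ + _); apply: eq_card => x.
    rewrite !inE; case xD: (x \in D); rewrite ?andbF //.
    by rewrite (subsetP DB) ?andbT.
  by rewrite !inE andbCA.
have cBD : #|B :\: A :\: S| = #|B :\: A' :\: S| %[mod period m s].
  apply/eqP; rewrite -(eqn_modDl #|A :\: S|) (cB A) // -(cB A') //.
  by rewrite -[eqbLHS]modnDml -[eqbRHS]modnDml cD.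
have [le_i le_j] : i <= s /\ j <= s.
  by split; apply: leq_trans le_s; rewrite ?leq_addr ?leq_addl.
rewrite -!mulnA -[LHS]modnMmr -[RHS]modnMmr; congr ((_ * _) %% _).
rewrite !mulnA -[LHS]modnMml -[RHS]modnMml; congr ((_ * _) %% _).
rewrite -[LHS]modnMm -[RHS]modnMm (bin_mod_period m_gt0 le_i cD).
by rewrite (bin_mod_period m_gt0 le_j cBD).
Qed.

(** * Circuit automorphisms and the transport of supports *)

(** By acyclicity, the set of gates from which a gate can be reached grows strictly along wires; its
    size is the induction measure. *)
Lemma gate_ind m n (C : mod_circuit m n) (P : gate C -> Prop) :
  (forall g, (forall a, 0 < wires a g -> P a) -> P g) -> forall g, P g.
Proof.
move=> PS; pose e (c d : gate C) := 0 < wires c d.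
pose d g := #|[set a | connect e a g]|.
have d_lt a b : 0 < wires a b -> d a < d b.
  move=> ab; apply/proper_card/properP; split.
    by apply/subsetP=> c; rewrite !inE => /connect_trans; apply; apply: connect1.
  by exists b; rewrite !inE ?connect0 // (negPf (wires_acyclic ab)).
move=> g; have [t] := ubnP (d g); elim: t g => // t IH g lt_t.
by apply: PS => a /d_lt ag; apply: IH; apply: leq_trans ag _.
Qed.

Lemma circuit_autP m n (C : mod_circuit m n) (s : {perm gate C}) :
  reflect [/\ s (output C) = output C, forall g, label (s g) = label g
            & forall a b, wires (s a) (s b) = wires a b]
          (s \in circuit_aut C).
Proof.
rewrite inE; apply: (iffP and3P).
  move=> [/eqP so /forallP sl /forallP sw]; split=> // [g|a b].
    exact/eqP/sl.
  by have /forallP/(_ b)/eqP := sw a.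
move=> [so sl sw]; split; first exact/eqP.
  by apply/forallP=> g; rewrite sl.
by apply/forallP=> a; apply/forallP=> b; rewrite sw.
Qed.

(** A tree automorphism preserving [B] is kept paired with a circuit automorphism extending it, so
    that both are composed and inverted together. *)
Definition block_aut m n h (k : 'I_h -> nat) (C : mod_circuit m n)
    (T : level_tree n k) (B : {set node T}) (p : {perm node T})
    (s : {perm gate C}) : Prop :=
  [/\ p \in tree_aut T, s \in circuit_aut C, extends p s
    & [set p x | x in B] = B].

Lemma extendsE m n h (k : 'I_h -> nat) (C : mod_circuit m n)
    (T : level_tree n k) p (s : {perm gate C}) i j :
  extends p s -> p (leaf T i) = leaf T j -> s (input C i) = input C j.
Proof.
move=> /forallP/(_ i)/forallP/(_ j)/implyP + pij.
by rewrite pij eqxx => /(_ isT)/eqP.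
Qed.

Lemma block_aut_mul m n h (k : 'I_h -> nat) (C : mod_circuit m n)
    (T : level_tree n k) (B : {set node T}) p q (s t : {perm gate C}) :
  block_aut B p s -> block_aut B q t -> block_aut B (p * q)%g (s * t)%g.
Proof.
move=> [pT sC ps pB] [qT tC qt qB]; split.
- exact: tree_aut_mul.
- case/circuit_autP: sC tC => so sl sw /circuit_autP[to tl tw].
  by apply/circuit_autP; split=> *; rewrite !permM ?so ?to ?sl ?tl ?sw ?tw // tl sl.
- apply/forallP=> i; apply/forallP=> j; apply/implyP; rewrite !permM.
  have [l pil] := tree_aut_leaf i pT; rewrite pil => /eqP qlj.
  by rewrite (extendsE ps pil) (extendsE qt qlj).
- rewrite -[RHS]qB -[in RHS]pB -imset_comp.
  by apply: eq_imset => x; rewrite permM.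
Qed.

Lemma block_aut_inv m n h (k : 'I_h -> nat) (C : mod_circuit m n)
    (T : level_tree n k) (B : {set node T}) p (s : {perm gate C}) :
  block_aut B p s -> block_aut B p^-1%g s^-1%g.
Proof.
move=> [pT sC ps pB]; split.
- exact: tree_aut_inv.
- case/circuit_autP: sC => so sl sw; apply/circuit_autP; split.
  + by rewrite -[X in (s^-1)%g X]so permK.
  + by move=> g; rewrite -sl permKV.
  + by move=> a b; rewrite -sw !permKV.
- apply/forallP=> i; apply/forallP=> j; apply/implyP=> /eqP pij.
  have pji : p (leaf T j) = leaf T i by rewrite -pij permKV.
  by rewrite -(extendsE ps pji) permK.
- rewrite -[in LHS]pB -imset_comp -[RHS]imset_id.
  by apply: eq_imset => x /=; rewrite permK.
Qed.

Lemma block_aut_mem m n h (k : 'I_h -> nat) (C : mod_circuit m n)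
    (T : level_tree n k) (B : {set node T}) p (s : {perm gate C}) x :
  block_aut B p s -> (p x \in B) = (x \in B).
Proof. by move=> [_ _ _ pB]; rewrite -{1}pB mem_imset //; apply: perm_inj. Qed.

Lemma gate_supportP m n h (k : 'I_h -> nat) (C : mod_circuit m n)
    (T : level_tree n k) (B S : {set node T}) (g : gate C) :
  is_support (gate_stab T g) B S <->
  S \subset B /\ forall q, q \in Sym B -> {in S, forall x, q x = x} ->
    exists p s, [/\ block_aut B p s, s g = g & {in B, p =1 q}].
Proof.
have normB (p : {perm node T}) : [set p x | x in B] == B -> p \in ('N(B | 'P))%g.
  move=> /eqP pB; apply/astabsP=> x; rewrite /= /aperm -{1}pB mem_imset //.
  exact: perm_inj.
split=> -[SB qP]; split=> // q qB qS.
  have /imsetP[p] := qP q qB qS; rewrite !inE => /andP[/andP[pT /existsP[s]]].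
  move=> /and3P[sC ps /eqP sg] pB qE; exists p, s; split=> //.
    by split=> //; [rewrite inE | apply/eqP].
  by move=> x xB; rewrite qE restr_permE // normB.
have [p [s [[pT sC ps pB] sg pq]]] := qP q qB qS.
apply/imsetP; exists p.
  rewrite inE pB eqxx andbT inE pT; apply/existsP; exists s.
  by rewrite sC ps sg eqxx.
apply/permP=> x; have [xB|xB] := boolP (x \in B).
  by rewrite restr_permE ?pq // normB // pB.
rewrite (out_perm (restr_perm_on B p) xB).
by apply: out_perm xB; move: qB; rewrite inE.
Qed.

Lemma support_aut m n h (k : 'I_h -> nat) (C : mod_circuit m n)
    (T : level_tree n k) (B S : {set node T}) (g : gate C) p (s : {perm gate C}) :
  block_aut B p s -> is_support (gate_stab T g) B S ->
  is_support (gate_stab T (s g)) B [set p x | x in S].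
Proof.
move=> ps /gate_supportP[SB Sg]; apply/gate_supportP; split.
  by apply/subsetP=> _ /imsetP[x xS ->]; rewrite (block_aut_mem _ ps) (subsetP SB).
(* Products apply the left factor first, so this conjugate sends [x] to [p^-1 (q (p x))] and fixes
   [S] pointwise. *)
move=> q qB qS; have [||p' [s' [ps' s'g p'q]]] := Sg (p * q * p^-1)%g.
- rewrite inE; apply/subsetP=> x; rewrite inE !permM; apply: contraR => xB.
  have -> : q (p x) = p x; last by rewrite permK.
  apply: (@out_perm _ B); first by move: qB; rewrite inE.
  by rewrite (block_aut_mem _ ps).
- by move=> x xS; rewrite !permM qS ?permK // imset_f.
exists (p^-1 * p' * p)%g, (s^-1 * s' * s)%g; split.
- exact: block_aut_mul (block_aut_mul (block_aut_inv ps) ps') ps.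
- by rewrite !permM permK s'g.
move=> x xB; rewrite !permM p'q ?permM ?permKV //.
by rewrite (block_aut_mem _ (block_aut_inv ps)).
Qed.

(** If the two sets differed, minimality at [s g] would make [supp (s g)] strictly smaller than
    [supp g]; pulled back along [p], it would be a support of [g] beating the minimal one. *)
Lemma min_support_aut m n h (k : 'I_h -> nat) (C : mod_circuit m n)
    (T : level_tree n k) (B : {set node T}) (supp : gate C -> {set node T}) :
  (forall g, is_min_support (gate_stab T g) B (supp g)) ->
  forall p s g, block_aut B p s -> supp (s g) = [set p x | x in supp g].
Proof.
move=> suppP p s g ps; apply/eqP; apply: contraT => /eqP ne.
have [sup_sg min_sg] := suppP (s g); have [sup_g min_g] := suppP g.
have := min_sg _ (support_aut ps sup_g) (nesym ne).
rewrite (card_imset _ perm_inj) => lt_sg.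
have := support_aut (block_aut_inv ps) sup_sg; rewrite permK => sup_g'.
have := min_g _ sup_g'; rewrite (card_imset _ perm_inj) ltnNge (ltnW lt_sg).
case/(_ _)/notF => eq_g; move: lt_sg; rewrite -eq_g.
by rewrite (card_imset _ perm_inj) ltnn.
Qed.

(** * Inputs given by subsets of the block, and gate values on them *)

(** Leaves not below [B] are set to 1, so that [A = B] gives the all-ones input. *)
Definition block_input h n (k : 'I_h -> nat) (T : level_tree n k)
    (B A : {set node T}) : {ffun 'I_n -> bool} :=
  [ffun i => ~~ [exists b in B :\: A, connect (@child _ _ _ T) b (leaf T i)]].

Lemma block_input_aut m n h (k : 'I_h -> nat) (C : mod_circuit m n)
    (T : level_tree n k) (B A : {set node T}) p (s : {perm gate C}) i j :
  block_aut B p s -> p (leaf T i) = leaf T j ->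
  block_input B [set p x | x in A] j = block_input B A i.
Proof.
move=> ps pij; rewrite !ffunE; congr (~~ _).
have pT : p \in tree_aut T by case: ps.
have memD x : (p x \in B :\: [set p y | y in A]) = (x \in B :\: A).
  by rewrite !inE (block_aut_mem _ ps) mem_imset //; apply: perm_inj.
apply/exists_inP/exists_inP => -[b bD bi].
  exists (p^-1 b)%g; first by rewrite -memD permKV.
  by rewrite -(tree_aut_connect _ _ pT) permKV pij.
by exists (p b); rewrite ?memD // -pij tree_aut_connect.
Qed.

(** [v'] composed with [s] is an evaluation on the input of [A], hence equals [v] by uniqueness. *)
Lemma evaluation_aut m n h (k : 'I_h -> nat) (C : mod_circuit m n)
    (T : level_tree n k) (B A : {set node T}) p (s : {perm gate C}) v v' g :
  block_aut B p s -> evaluation (block_input B A) v ->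
  evaluation (block_input B [set p x | x in A]) v' -> v' (s g) = v g.
Proof.
move=> ps vP [v'i v'g]; have [pT /circuit_autP[_ sl sw] es _] := ps.
have [w [_ wP]] := evaluation_exists_unique C (block_input B A).
suff /wP wE : evaluation (block_input B A) [ffun a => v' (s a)].
  by rewrite -(wP v vP) wE ffunE.
split=> [i|a R aR]; rewrite ffunE.
  have [j pij] := tree_aut_leaf i pT.
  by rewrite (extendsE es pij) v'i (block_input_aut A ps pij).
rewrite (v'g _ R) ?sl // (reindex_inj (@perm_inj _ s)).
by congr ((_%:R)%R \in R); apply: eq_bigr => b _; rewrite ffunE sw.
Qed.

Lemma block_level h n (k : 'I_h -> nat) (T : level_tree n k) (B : {set node T}) :
  is_block B -> {in B &, forall b b', level b = level b'}.
Proof.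
move=> [u ->] b b'; rewrite !inE => /level_child + /level_child => -> [].
by [].
Qed.

(** If [b] and another [b'] were both outside [S], an automorphism swapping them would fix the leaf
    [i], which would then lie below two nodes of the same level. So a support small compared with
    [B] must contain [b]. *)
Lemma input_support m n h (k : 'I_h -> nat) (C : mod_circuit m n)
    (T : level_tree n k) (B S : {set node T}) i b :
  is_block B -> b \in B -> connect (@child _ _ _ T) b (leaf T i) ->
  is_support (gate_stab T (input C i)) B S -> b \notin S -> #|B| <= #|S|.+1.
Proof.
move=> Bblock bB bi /gate_supportP[SB Sg] bS.
suff sBS : B \subset b |: S by rewrite (leq_trans (subset_leq_card sBS)) // cardsU1 bS.
apply/subsetP=> b' b'B; rewrite !inE; apply: contraT; rewrite negb_or => /andP[ne b'S].
have [||p [s [[pT _ ps _] si pq]]] := Sg (tperm b b').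
- rewrite inE; apply/subsetP=> x; rewrite inE; apply: contraR => xB.
  by rewrite tpermD //; apply: contraNneq xB => <-.
- by move=> x xS; rewrite tpermD //; [move: bS | move: b'S]; apply: contraNneq => ->.
have [j pij] := tree_aut_leaf i pT.
have ij : i = j by apply: (@input_inj _ _ C); rewrite -(extendsE ps pij).
have b'i : connect (@child _ _ _ T) b' (leaf T i).
  by move: bi; rewrite -(tree_aut_connect _ _ pT) pij -ij pq // tpermL.
by rewrite (connect_level (block_level Bblock b'B bB) b'i bi) eqxx in ne.
Qed.

Lemma block_input_below h n (k : 'I_h -> nat) (T : level_tree n k)
    (B A : {set node T}) i b :
  is_block B -> b \in B -> connect (@child _ _ _ T) b (leaf T i) ->
  block_input B A i = (b \in A).
Proof.
move=> Bblock bB bi; rewrite ffunE -[RHS]negbK; congr (~~ _).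
apply/exists_inP/idP => [[b']|bA].
  rewrite inE => /andP[b'A b'B] b'i.
  by rewrite (connect_level (block_level Bblock bB b'B) bi b'i).
by exists b => //; rewrite inE bA.
Qed.

Lemma gate_value_local m n h (k : 'I_h -> nat) (C : mod_circuit m n)
    (T : level_tree n k) (B : {set node T}) (supp : gate C -> {set node T}) t
    (V : {set node T} -> {ffun gate C -> bool}) :
  1 < m -> is_block B -> t.+1 < #|B| ->
  (forall g, is_min_support (gate_stab T g) B (supp g)) ->
  (forall g, #|supp g| <= t) ->
  (forall A, evaluation (block_input B A) (V A)) ->
  forall g (A A' : {set node T}), A \subset B -> A' \subset B ->
    A :&: supp g = A' :&: supp g -> #|A| = #|A'| %[mod period m t] ->
    V A g = V A' g.
Proof.
move=> m_gt1 Bblock tB suppP supp_le VP; elim/gate_ind => g IH A A' AB A'B AS cA.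
have supB a : supp a \subset B by case: (suppP a) => -[].
case gl: (label g) => [R|]; last first.
  have /eqP := gl; rewrite input_label => /codomP[i gi]; rewrite gi.
  rewrite !(proj1 (VP _)).
  have [/exists_inP[b bB bi]|no] :=
      boolP [exists b in B, connect (@child _ _ _ T) b (leaf T i)].
    rewrite !(block_input_below _ Bblock bB bi).
    have bS : b \in supp g.
      apply: contraLR tB => bS; rewrite -leqNgt.
      rewrite gi in bS; have [sup_i _] := suppP (input C i).
      by rewrite (leq_trans (input_support Bblock bB bi sup_i bS)) // ltnS supp_le.
    by move/setP/(_ b): AS; rewrite !inE bS !andbT.
  have triv (D : {set node T}) : block_input B D i = true.
    rewrite ffunE; apply: contraNT no; rewrite negbK => /exists_inP[b].
    by rewrite inE => /andP[_ bB] bi; apply/exists_inP; exists b.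
  by rewrite !triv.
rewrite !((proj2 (VP _)) _ _ gl); congr (_ \in R).
rewrite -(Zp_nat_mod m_gt1) -[RHS](Zp_nat_mod m_gt1); congr (_%:R)%R.
pose w (D E : {set node T}) := \sum_(a | supp a == E) wires a g * V D a.
have sum_w D : \sum_a wires a g * V D a = \sum_E w D E.
  by rewrite (partition_big supp xpredT).
rewrite !sum_w; apply: (sum_trace_mod (ltnW m_gt1) (supB g) AB A'B AS cA).
  move=> D E; apply: contraNeq => w_neq0.
  have [a /eqP<-|none] := pickP (fun a => supp a == E); first by rewrite supB supp_le.
  by rewrite /w big_pred0 ?eqxx in w_neq0.
have AA'P (D D' : {set node T}) : D \in [:: A; A'] -> D' \in [:: A; A'] ->
    [/\ D \subset B, D' \subset B, D :&: supp g = D' :&: supp g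
      & #|D| = #|D'| %[mod period m t]].
  by rewrite !inE => /orP[] /eqP-> /orP[] /eqP->.
move=> D D' E E' DA D'A EB E'B tr; have [DB D'B DS cD] := AA'P _ _ DA D'A.
have [q [qB qS qE qD]] := trace_perm EB E'B DS tr.
(* Since [q] fixes [supp g], it extends to an [s] fixing [g]; this [s] matches the sources with
   support [E'] to those with support [E]. *)
have [/gate_supportP[_ /(_ q qB qS)] [p [s [ps sg pq]]] _] := suppP g.
have pE : [set p x | x in E'] = E.
  by rewrite -qE; apply: eq_in_imset => x xE; rewrite pq // (subsetP E'B).
have sw a b : wires (s a) (s b) = wires a b.
  by case: ps => _ /circuit_autP[].
rewrite /w (reindex_inj (@perm_inj _ s)); apply: eq_big => a.
  rewrite (min_support_aut suppP _ ps) -pE.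
  by apply/eqP/eqP => [/imset_inj->//|->//]; apply: perm_inj.
move=> /eqP supp_sa; rewrite -{1}sg sw.
have [->|wa] := posnP (wires a g); first by rewrite !mul0n.
congr (_ * nat_of_bool _); rewrite -(evaluation_aut a ps (VP D') (VP _)).
(* The induction hypothesis at [s a] compares the image of [D'] under [p] with [D]: they agree on
   [E], the support of [s a], and have congruent sizes. *)
apply/esym/IH => //; first by rewrite -sg sw.
- by apply/subsetP=> _ /imsetP[x xD ->]; rewrite (block_aut_mem _ ps) (subsetP D'B).
- apply/setP=> y; rewrite !inE supp_sa -pE; case yE: (y \in [set p x | x in E']); rewrite ?andbF //.
  rewrite !andbT; case/imsetP: yE => x xE ->; rewrite mem_imset; last exact: perm_inj.
  by rewrite -qD // pq // (subsetP E'B).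
- by rewrite (card_imset _ perm_inj) cD.
Qed.

(** * The output gate and the final contradiction *)

(** Every permutation of [B] lifts to the tree, and circuit automorphisms fix the output gate. *)
Lemma output_support m n h (k : 'I_h -> nat) (C : mod_circuit m n)
    (T : level_tree n k) (B : {set node T}) :
  tree_symmetric C T -> is_block B -> is_support (gate_stab T (output C)) B set0.
Proof.
move=> Csym Bblock; apply/gate_supportP; split=> [|q qB _]; first exact: sub0set.
have [p pT pq] := perm_block_lifts Bblock qB; have [s sC ps] := Csym _ pT.
exists p, s; split=> //; last by case/circuit_autP: sC.
split=> //; apply/eqP; rewrite eqEcard (card_imset _ perm_inj) leqnn andbT.
apply/subsetP=> _ /imsetP[x xB ->]; rewrite pq // perm_closed //.
by move: qB; rewrite inE.
Qed.

Lemma lt_root_nat (R : realType) (m k s r : nat) : 0 < m -> 0 < r ->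
  (s%:R < (k%:R / m%:R : R) `^ r%:R^-1)%R -> m * s ^ r < k.
Proof.
move=> m_gt0 r_gt0 lt_s.
have km_ge0 : (0 <= k%:R / m%:R :> R)%R by rewrite divr_ge0.
have : (s%:R ^+ r < ((k%:R / m%:R : R) `^ r%:R^-1) ^+ r)%R.
  by rewrite ltrXn2r // ?powR_ge0 // -lt0n.
rewrite -(powR_mulrn _ (powR_ge0 _ _)) -powRrM mulVf ?pnatr_eq0 -?lt0n //.
rewrite powRr1 // ltr_pdivlMr ?ltr0n // -natrX -natrM ltr_nat mulnC.
by [].
Qed.

Theorem theorem4p1 (R : realType) (m : nat) (hm : (3 < m)%N)
  (h : nat) (k : 'I_h -> nat -> nat)
  (hk : forall n, (\prod_(i < h) k i n)%N = n)
  (n : nat) (hn : (0 < n)%N)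
  (T : level_tree n (fun i => k i n))
  (C : mod_circuit m n) (hsym : tree_symmetric C T) (hrigid : rigid C)
  (B : {set node T}) (hB : is_block B)
  (j : 'I_h) (hBj : #|B| = k j n) (hj : (1 < k j n)%N)
  (supp : gate C -> {set node T})
  (hsupp : forall g, is_min_support (gate_stab T g) B (supp g))
  (hmax : ((\max_(g : gate C) #|supp g|)%N%:R
            < ((k j n)%:R / m%:R : R) `^ ((size (primes m))%:R^-1))%R) :
  ~ computes C (@AND n).
Proof.
move=> hC; have m_gt0 : 0 < m by apply: leq_trans hm.
have m_gt1 : 1 < m by apply: leq_trans hm.
set t := \max_g #|supp g| in hmax.
have supp_le g : #|supp g| <= t by apply: leq_bigmax.
have r_gt0 : 0 < size (primes m).
  have : pdiv m \in primes m by rewrite mem_primes pdiv_prime // m_gt0 pdiv_dvd.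
  by case: (primes m).
have mtk := lt_root_nat m_gt0 r_gt0 hmax.
have k_gt0 i : 0 < k i n.
  rewrite lt0n; apply: contraTneq hn => ki0.
  by rewrite -(hk n) (bigD1 i) //= ki0 mul0n.
have /card_gt0P[b0 b0B] : 0 < #|B| by rewrite hBj ltnW.
(* With [t = 0], an input below [b0] would have empty support, forcing [#|B| <= 1]. Positivity is
   needed for [period_le]. *)
have t_gt0 : 0 < t.
  have [i bi] := leaf_below b0 k_gt0; rewrite lt0n; apply: contraTneq hj => t0.
  have S0 : supp (input C i) = set0.
    by apply/eqP; rewrite -cards_eq0 -leqn0 -t0.
  have [sup_i _] := hsupp (input C i); rewrite S0 in sup_i.
  have := input_support hB b0B bi sup_i.
  by rewrite inE cards0 hBj -leqNgt; apply.
(* With [r = size (primes m)], the chain is [t + 1 <= 2 * t <= m * t ^ r < #|B|]. *)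
have tB : t.+1 < #|B|.
  rewrite hBj (leq_ltn_trans _ mtk) //.
  apply: (@leq_trans (2 * t)); first by rewrite mul2n -addnn -addn1 leq_add2l.
  by rewrite leq_mul // -[leqLHS]expn1 leq_pexp2l.
have QB : period m t < #|B| by rewrite hBj (leq_ltn_trans (period_le _ t_gt0)).
have Q_gt0 : 0 < period m t.
  rewrite muln_gt0 m_gt0 big_seq prodn_cond_gt0 // => p.
  by rewrite mem_primes => /andP[/prime_gt0 p_gt0 _]; rewrite expn_gt0 p_gt0.
have [V VP Vout] := fin_all_exists2 hC.
(* The size of this [A] is congruent to that of [B] modulo the period, yet [A] is a proper
   subset. *)
have : 0 < #|[set A : {set node T} | (A \subset B) && (#|A| == #|B| - period m t)]|.
  by rewrite cards_draws bin_gt0 leq_subr.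
move=> /card_gt0P[A]; rewrite inE => /andP[AB /eqP cA].
have S0 : supp (output C) = set0.
  have [_ min_o] := hsupp (output C); apply/esym/eqP; apply: contraT => /eqP ne.
  by have := min_o _ (output_support hsym hB) ne; rewrite cards0.
have := @gate_value_local _ _ _ _ _ _ _ _ t (V \o block_input B) m_gt1 hB tB
  hsupp supp_le (fun D => VP _) (output C) B A (subxx _) AB.
rewrite S0 !setI0 => /(_ erefl); rewrite cA /= !Vout => vBA.
have /vBA : #|B| = #|B| - period m t %[mod period m t].
  by rewrite -{1}(subnK (ltnW QB)) modnDr.
have -> : AND (block_input B B) = true.
  apply/forallP=> i; rewrite ffunE setDv; apply/exists_inP => -[b].
  by rewrite inE.
(* A leaf below a node [b] missed by [A] has value 0, so the conjunction fails on the input of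
   [A]. *)
have /subsetPn[b bB bA] : ~~ (B \subset A).
  apply: contraTN Q_gt0 => /subset_leq_card; rewrite cA -leqNgt => le_B.
  by rewrite -(leq_add2r (#|B| - period m t)) add0n subnKC ?(ltnW QB).
have [i bi] := leaf_below b k_gt0.
by move/esym/forallP/(_ i); rewrite (block_input_below A hB bB bi) (negPf bA).
Qed.
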